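(* Let $L\ge1$ be an integer and let $\alpha,\beta>0$. For each $\rho>0$ let $\gamma_1,\dots,\gamma_L$ be independent and identically distributed nonnegative random variables with cumulative distribution function $F(\gamma)=\frac{1}{1+(\gamma/(\rho\alpha))^{-\beta}}$ for $\gamma>0$, let $f_{\gamma_{SC}}$ be the probability density function of $\gamma_{SC}=\max\{\gamma_1,\dots,\gamma_L\}$, and let $C(\rho)=\frac{1}{\ln 2}\int_0^\infty\ln(1+\gamma)f_{\gamma_{SC}}(\gamma)\,d\gamma$ be the ergodic capacity. Then $$\lim_{\rho\to\infty}\left(C(\rho)-\log_2(\rho)-\frac{\beta\ln(\alpha)+E_0+\Psi(L)}{\beta\ln(2)}\right)=0,$$ where $E_0$ is the Euler–Mascheroni constant and $\Psi$ is the digamma function.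
   Context: The digamma function is $\Psi(x)=\Gamma'(x)/\Gamma(x)$. In the application, $\gamma_l$ is the SNR of the $l$-th branch of a selection combining receiver and $\rho$ is the average transmit SNR. *)

(* Defs.v *)
From HB Require Import structures.
From mathcomp Require Import all_boot all_order all_algebra.
From mathcomp Require Import all_classical all_reals all_analysis.
From mathcomp Require Import measurable_realfun.

Set Implicit Arguments.
Unset Strict Implicit.
Unset Printing Implicit Defensive.

Import Order.TTheory GRing.Theory Num.Theory.
Import numFieldNormedType.Exports.

Local Open Scope classical_set_scope.
Local Open Scope ring_scope.

Definition Gamma {R : realType} (x : R) : R :=
  Rintegral lebesgue_measure `]0, +oo[ (fun t : R => t `^ (x - 1) * expR (- t)).

Definition digamma {R : realType} (x : R) : R := Gamma^`()%classic x / Gamma x.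

(* [series harmonic n] is 1 + 1/2 + ... + 1/n. *)
Definition euler_mascheroni (R : realType) : R :=
  limn (fun n : nat => series harmonic n - ln n%:R : R).

Definition log2 {R : realType} (x : R) : R := ln x / ln 2.

Definition mutually_independent d (T : measurableType d) (R : realType)
    (P : probability T R) (I : finType) (X : I -> {RV P >-> R}) : Prop :=
  forall (J : {set I}) (A : I -> set R), (forall i, measurable (A i)) ->
    P (\bigcap_(i in [set` J]) (X i @^-1` A i)) =
    (\prod_(i in J) P (X i @^-1` A i))%E.

Definition is_pdf d (T : measurableType d) (R : realType)
    (P : probability T R) (X : {RV P >-> R}) (f : R -> R) : Prop :=
  [/\ measurable_fun setT f,
      forall x, 0 <= f x &
      forall A : set R, measurable A ->
        distribution P X A = (\int[lebesgue_measure]_(x in A) (f x)%:E)%E].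

(* The default value 0 of the iterated maximum is harmless for a nonempty
   family of nonnegative random variables. *)
Definition max_snr d (T : measurableType d) (R : realType)
    (P : probability T R) (L : nat) (X : 'I_L -> {RV P >-> R}) (t : T) : R :=
  \big[Order.max/0]_(l < L) X l t.

Section max_snr_measurable.
Context d (T : measurableType d) (R : realType) (P : probability T R).
Context (L : nat) (X : 'I_L -> {RV P >-> R}).

Let measurable_max_snr : measurable_fun setT (max_snr X).
Proof.
rewrite /max_snr; elim: (index_enum _) => [|l s IH].
  by under eq_fun do rewrite big_nil; exact: measurable_cst.
under eq_fun do rewrite big_cons.
by apply: measurable_maxr => //.
Qed.

HB.instance Definition _ :=
  isMeasurableFun.Build _ _ T R (max_snr X) measurable_max_snr.

End max_snr_measurable.

Definition sc_snr d (T : measurableType d) (R : realType)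
    (P : probability T R) (L : nat) (X : 'I_L -> {RV P >-> R}) :
    {RV P >-> R} := max_snr X.

(* Meaningful for 0 < x only: [0 `^ (- beta)] is 0, so the value at 0 would be 1. *)
Definition loglogistic_cdf {R : realType} (scale beta x : R) : R :=
  (1 + (x / scale) `^ (- beta))^-1.

(* Valued in the extended reals, so that a divergent integral is +oo and is
   not silently replaced by a real default value. *)
Definition ergodic_capacity {R : realType} (f : R -> R) : \bar R :=
  (((ln 2)^-1)%:E *
   \int[lebesgue_measure]_(x in `]0%R, +oo[) (ln (1 + x) * f x)%:E)%E.

(* Main.v *)
Require Import Defs.
From HB Require Import structures.
From mathcomp Require Import all_boot all_order all_algebra.
From mathcomp Require Import all_classical all_reals all_analysis.
From mathcomp Require Import measurable_realfun ring lra.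
Import Order.TTheory GRing.Theory Num.Theory.
Import numFieldNormedType.Exports.

Set Implicit Arguments.
Unset Strict Implicit.
Unset Printing Implicit Defensive.

Local Open Scope classical_set_scope.
Local Open Scope ring_scope.

(** Put [s = rho * alpha] and write [H_n] for the harmonic numbers.  Along
    [x = N * exp r] the distribution function of one branch is a logistic
    function [G] of [r], and [1 - G^L] has the explicit primitive
    [(ln G + sum_(k < L-1) G^(k+1) / (k+1)) / beta].  The tail formula thus
    gives [E (ln^+ (gamma_SC / N))] in closed form; it equals
    [ln (s / N) + H_(L-1) / beta] up to [O((N / s)^beta)].  As
    [ln^+ x <= ln (1 + x) <= ln (1 + N) + ln^+ (x / N)], taking [N = 1] on the
    left and [N = sqrt s] on the right squeezes [E (ln (1 + gamma_SC))] between
    two functions of the form [ln s + H_(L-1) / beta + o(1)].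

    It remains to see that [digamma L = H_(L-1) - E_0].  As in the
    Bohr-Mollerup theorem, the inequality [Gamma (x + h) <= x^h * Gamma x] for
    [0 <= h <= 1] pins the increments of [ln Gamma] far to the right, and the
    functional equation carries this back to [L] with a quadratic error. *)

(** * The Gamma function *)

Section gamma_integral.
Context {R : realType}.
Notation mu := (@lebesgue_measure R).

(** Kept in the extended reals so that the functional equation and the bound on [x + h] come first
    and finiteness is deduced from them; [Gamma] is its [fine] image. *)
Definition gamma_integral (x : R) : \bar R :=
  (\int[mu]_(t in `]0%R, +oo[) (t `^ (x - 1) * expR (- t))%:E)%E.

Lemma gamma_integral_ge0 x : (0 <= gamma_integral x)%E.
Proof.
by apply: integral_ge0 => t _; rewrite lee_fin mulr_ge0 ?powR_ge0 ?expR_ge0.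
Qed.

Lemma measurable_gamma_integrand x (D : set R) :
  measurable_fun D (fun t : R => (t `^ (x - 1) * expR (- t))%:E).
Proof.
apply/measurable_EFinP/measurable_funM.
  by apply: measurable_funTS; exact: measurable_powR.
apply: measurableT_comp; first exact: measurable_expR.
by apply: measurableT_comp => //; exact: oppr_measurable.
Qed.

Lemma is_derive_powR (x a : R) : 0 < x ->
  is_derive x 1 (@powR R ^~ a) (a * x `^ (a - 1)).
Proof.
move=> x0; have x0' : x \in `]0, +oo[ by rewrite in_itv/= x0.
by split; [exact: derivable_powR|rewrite -derive1E powR_derive1].
Qed.

Lemma continuous_powR (x a : R) : 0 < x -> {for x, continuous (@powR R ^~ a)}.
Proof.
move=> x0; apply/differentiable_continuous/derivable1_diffP.
by have [] := is_derive_powR a x0.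
Qed.

Lemma continuous_expRN : continuous (fun x : R => expR (- x)).
Proof. by move=> x; apply: continuous_comp;
  [exact: continuousN|exact: continuous_expR]. Qed.

Lemma gamma_parts (x a b : R) : 0 < a -> a < b ->
  (\int[mu]_(t in `[a, b]) (t `^ (x + 1 - 1) * expR (- t))%:E =
   (a `^ x * expR (- a) - b `^ x * expR (- b))%:E
   + x%:E * \int[mu]_(t in `[a, b]) (t `^ (x - 1) * expR (- t))%:E)%E.
Proof.
move=> a0 ab.
have cont c : {within `[a, b], continuous (@powR R ^~ c : R -> R)}.
  apply: continuous_in_subspaceT => z; rewrite inE/= in_itv/= => /andP[az _].
  exact/continuous_powR/(lt_le_trans a0).
rewrite addrK.
rewrite (@integration_by_parts _ (fun t => t `^ x) (fun t => - expR (- t))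
  (fun t => x * t `^ (x - 1)) (fun t => expR (- t)))//; last 6 first.
- move=> z; apply: cvgM; first exact: cvg_cst.
  exact: cont.
- split.
  + move=> z /[!in_itv]/= /andP[az _].
    by have [] := is_derive_powR x (lt_trans a0 az).
  + exact/cvg_at_right_filter/continuous_powR.
  + exact/cvg_at_left_filter/continuous_powR/(lt_trans a0).
- move=> z /[!in_itv]/= /andP[az _].
  by rewrite derive1E; have [_ ->] := is_derive_powR x (lt_trans a0 az).
- by apply: continuous_subspaceT; exact: continuous_expRN.
- split.
  + by move=> z _; exact: ex_derive.
  + by apply/cvg_at_right_filter; apply: cvgN; exact: continuous_expRN.
  + by apply/cvg_at_left_filter; apply: cvgN; exact: continuous_expRN.
- by move=> z _; rewrite derive1E derive_val; ring.
have i : mu.-integrable `[a, b] (fun t => (t `^ (x - 1) * expR (- t))%:E).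
  apply: continuous_compact_integrable; first exact: segment_compact.
  move=> z; apply: cvgM; first exact: cont.
  by apply: continuous_subspaceT; exact: continuous_expRN.
have E (t : R) :
  x * t `^ (x - 1) * - expR (- t) = - x * (t `^ (x - 1) * expR (- t)) by ring.
under eq_integral do rewrite E EFinM.
rewrite integralZl// EFinN mulNe oppeK; congr (_%:E + _)%E; ring.
Qed.

(** Apply [ln u <= u] at [u = t / (2 * x)]; the factor 2 leaves half of the exponent, so that the
    bound still decays. *)
Lemma powR_expRN_le (x t : R) : 0 < x -> 0 < t ->
  t `^ x * expR (- t) <= (2 * x) `^ x * expR (- (t / 2)).
Proof.
move=> x0 t0; have x20 : 0 < 2 * x by rewrite mulr_gt0.
rewrite /powR !gt_eqF// -!expRD ler_expR.
have : ln (t / (2 * x)) <= t / (2 * x) by rewrite ltW// ln_sublinear ?divr_gt0.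
rewrite ln_div// => /(ler_wpM2l (ltW x0)).
rewrite (_ : x * (t / (2 * x)) = t / 2); last by field; rewrite gt_eqF.
lra.
Qed.

Lemma cvg_powR_expRN (x : R) : 0 < x -> t `^ x * expR (- t) @[t --> +oo] --> 0.
Proof.
move=> x0.
have h : (2 * x) `^ x * expR (- (t / 2)) @[t --> +oo] --> 0.
  rewrite -[X in _ --> X](mulr0 ((2 * x) `^ x)); apply: cvgMr.
  apply: (cvg_comp _ _ _ (@cvgr_expR R)).
  apply: gt0_cvgMly => //; exact: cvg_id.
apply: (squeeze_cvgr _ (cvg_cst 0) h); near=> t.
by rewrite mulr_ge0 ?powR_ge0 ?expR_ge0//= powR_expRN_le.
Unshelve. all: by end_near. Qed.

(** Starting at [n.+2] keeps the two endpoints strictly ordered, as [gamma_parts] demands. *)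
Lemma bigcup_itv_pos : \bigcup_n `[(n.+2%:R : R)^-1, n.+2%:R]%classic
  = `]0, +oo[%classic.
Proof.
apply/seteqP; split => [t [n _]|t]/=; rewrite !in_itv/= andbT.
  by move=> /andP[+ _]; apply: lt_le_trans; rewrite invr_gt0.
(* For this index [n], [n.+1] exceeds [t + t^-1], hence both [t] and [t^-1], which settles the two
   endpoints at once. *)
move=> t0; exists (Num.trunc (t + t^-1)) => //=; rewrite in_itv/=.
have := truncnS_gt (t + t^-1); set n := Num.trunc _ => h.
have ti0 : 0 < t^-1 by rewrite invr_gt0.
have n0 : (n.+2%:R = n.+1%:R + 1 :> R) by rewrite -natr1.
apply/andP; split; last by rewrite n0; lra.
by rewrite -[leRHS]invrK lef_pV2 ?posrE// n0; lra.
Qed.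

Lemma cvg_gamma_integral (x : R) :
  (\int[mu]_(t in `[((n.+2%:R : R)^-1)%R, (n.+2%:R : R)%R]) (t `^ (x -
    1) * expR (- t))%:E)%E
   @[n --> \oo] --> gamma_integral x.
Proof.
have := @ge0_nondecreasing_set_cvg_integral _ (measurableTypeR R) R
  (fun n => `[(n.+2%:R : R)^-1, n.+2%:R]%classic)
  (fun t : R => (t `^ (x - 1) * expR (- t))%:E) mu.
rewrite bigcup_itv_pos; apply => //.
- move=> m n mn; apply/subsetPset => t; rewrite /= !in_itv/= => /andP[mt tm].
  rewrite (le_trans _ mt) ?lef_pV2 ?posrE ?ler_nat ?ltnS//=.
  by rewrite (le_trans tm)// ler_nat !ltnS.
- by move=> n; exact: measurable_gamma_integrand.
- by move=> n t _; rewrite lee_fin mulr_ge0 ?powR_ge0 ?expR_ge0.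
Qed.

(** Let the segments of [gamma_parts] exhaust the half-line: the boundary terms [B] vanish at both
    ends, and the limit makes sense even for infinite integrals. *)
Lemma gamma_integralS (x : R) : 0 < x ->
  gamma_integral (x + 1) = (x%:E * gamma_integral x)%E.
Proof.
move=> x0.
pose a n : R := n.+2%:R.
have ab n : (a n)^-1 < a n.
  by rewrite (@lt_le_trans _ _ 1) ?ler1n// invf_lt1 ?ltr1n.
have a0 n : 0 < (a n)^-1 by rewrite invr_gt0.
pose B n : R := (a n)^-1 `^ x * expR (- (a n)^-1) - (a n) `^ x * expR (- a n).
have B0 : B @ \oo --> 0.
  have cy : a @ \oo --> (+oo : set_system R).
    apply/cvgryPge => A; near=> n; apply: (@le_trans _ _ n%:R).
      by near: n; exact: nbhs_infty_ger.
    by rewrite ler_nat leqW.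
  have c0 : (a n)^-1 @[n --> \oo] --> 0.
    by apply/gtr0_cvgV0 => //; exact: nearW.
  rewrite -[X in _ --> X](subrr 0); apply: cvgB.
    rewrite -[X in _ --> X](mul0r (expR (- 0))); apply: cvgM.
      have /cvg_at_rightP := powR_cvg0 x0; apply.
      by split => // n; rewrite invr_gt0.
    exact: (cvg_comp _ _ c0 (@continuous_expRN 0)).
  exact: (cvg_comp _ _ cy (cvg_powR_expRN x0)).
have h : (\int[mu]_(t in `[((n.+2%:R : R)^-1)%R, (n.+2%:R : R)%R])
    (t `^ (x + 1 - 1) * expR (- t))%:E)%E @[n --> \oo] -->
    (0%:E + x%:E * gamma_integral x)%E.
  under eq_cvg => n do rewrite (gamma_parts x (a0 n) (ab n)).
  apply: cvgeD => //.
    by apply: cvg_EFin => //; exact: nearW.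
  by apply: cvgeZl => //; exact: cvg_gamma_integral.
rewrite -[RHS]add0e.
exact: (cvg_unique _ (@cvg_gamma_integral (x + 1)) h).
Unshelve. all: by end_near. Qed.
End gamma_integral.

(** * Finiteness, positivity and the Bohr-Mollerup inequality *)

Section gamma_function.
Context {R : realType}.
Notation mu := (@lebesgue_measure R).

Lemma gamma_integral1 : gamma_integral (1 : R) = 1%E.
Proof.
rewrite /gamma_integral.
rewrite integral_itv_obnd_cbnd; last exact: measurable_gamma_integrand.
under eq_integral do rewrite subrr powRr0 mul1r.
rewrite (@ge0_continuous_FTC2y _ _ (fun t => - expR (- t)) 0 0).
- by rewrite oppr0 expR0 EFinN oppeK add0e.
- by move=> t _; exact: expR_ge0.
- by apply: continuous_subspaceT; exact: continuous_expRN.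
- by rewrite -[X in _ --> X]oppr0; apply: cvgN; exact: cvgr_expR.
- by move=> t _; exact: ex_derive.
- by apply/cvg_at_right_filter; apply: cvgN; exact: continuous_expRN.
- by move=> t _; rewrite derive1E derive_val; ring.
Qed.

(** Concavity of [ln]: its tangent at [m = 1 - h + h * y] lies above it at [y] and at [1]. With
    weights [h] and [1 - h] the linear terms cancel, as [m] is the weighted mean. *)
Lemma powR_bernoulli (y h : R) : 0 < y -> 0 <= h <= 1 -> y `^ h
  <= 1 - h + h * y.
Proof.
move=> y0 /andP[h0 h1].
have m0 : 0 < 1 - h + h * y.
  have [->|hN0] := eqVneq h 0; first by rewrite subr0 mul0r addr0.
  by rewrite ltr_wpDl ?subr_ge0// mulr_gt0// lt_neqAle eq_sym hN0.
rewrite -ler_ln ?posrE ?powR_gt0// ln_powR.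
set m := _ + _ in m0 *.
have bound z : 0 < z -> ln z - ln m <= z / m - 1.
  move=> z0; rewrite -ln_div// -[X in ln X](subrKC 1); apply: le_ln1Dx.
  by rewrite ltrBrDl subrr divr_gt0.
have := lerD (ler_wpM2l h0 (bound y y0))
  (ler_wpM2l (_ : 0 <= 1 - h) (bound 1 ltr01)).
rewrite ln1 => /(_ ltac:(by rewrite subr_ge0)).
have -> : h * (y / m - 1) + (1 - h) * (1 / m - 1) = 0.
  by rewrite /m; field; rewrite gt_eqF.
lra.
Qed.

(* Integrate Bernoulli's bound for [(t / x) `^ h] against the density of
   [gamma_integral x] and apply the functional equation. *)
Lemma gamma_integral_wendel (x h : R) : 0 < x -> 0 <= h <= 1 ->
  (gamma_integral (x + h) <= (x `^ h)%:E * gamma_integral x)%E.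
Proof.
move=> x0 /[dup] h01 /andP[h0 h1].
have pos y (t : R) : 0 <= t `^ (y - 1) * expR (- t).
  by rewrite mulr_ge0 ?powR_ge0 ?expR_ge0.
have c1 : 0 <= x `^ h * (1 - h) by rewrite mulr_ge0 ?powR_ge0 ?subr_ge0.
have c2 : 0 <= x `^ h * h / x by rewrite !mulr_ge0 ?powR_ge0 ?invr_ge0// ltW.
have -> : ((x `^ h)%:E * gamma_integral x =
    (x `^ h * (1 - h))%:E * gamma_integral x
    + (x `^ h * h / x)%:E * gamma_integral (x + 1))%E.
  rewrite gamma_integralS// muleA -EFinM -ge0_muleDl ?lee_fin//; last first.
    by rewrite divfK ?gt_eqF// mulr_ge0 ?powR_ge0.
  by congr (_%:E * _)%E; field; rewrite gt_eqF.
rewrite /gamma_integral -!ge0_integralZl_EFin//; last 4 first.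
- by move=> t _; rewrite lee_fin.
- exact: measurable_gamma_integrand.
- by move=> t _; rewrite lee_fin.
- exact: measurable_gamma_integrand.
rewrite -ge0_integralD//; last 4 first.
- by move=> t _; rewrite -EFinM lee_fin mulr_ge0.
- by apply: measurable_funeM; exact: measurable_gamma_integrand.
- by move=> t _; rewrite -EFinM lee_fin mulr_ge0.
- by apply: measurable_funeM; exact: measurable_gamma_integrand.
apply: ge0_le_integral => //.
- by move=> t _; rewrite lee_fin.
- exact: measurable_gamma_integrand.
- by apply: emeasurable_funD; apply: measurable_funeM;
    exact: measurable_gamma_integrand.
move=> t; rewrite /= in_itv/= andbT => t0.
rewrite -!EFinM -EFinD lee_fin !mulrA -mulrDl ler_wpM2r ?expR_ge0//.
have tx0 : 0 < t / x by rewrite divr_gt0.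
have -> : t `^ (x + h - 1) = t `^ (x - 1) * (x `^ h * (t / x) `^ h).
  rewrite -powRM ?ltW// (mulrC x) divfK ?gt_eqF//.
  by rewrite -powRD ?(gt_eqF t0) ?implybT// addrAC.
have -> : t `^ (x + 1 - 1) = t `^ (x - 1) * t.
  by rewrite mulrC addrK mulr_powRB1// ltW.
apply: (@le_trans _ _ (t `^ (x - 1) * (x `^ h * (1 - h + h * (t / x))))).
  by rewrite !ler_wpM2l ?powR_ge0// powR_bernoulli.
by rewrite le_eqVlt; apply/orP; left; apply/eqP; field; rewrite gt_eqF.
Qed.

(** The functional equation carries both properties between [y] and [y + 1], so [0 < y <= 1]
    suffices. There the inequality from [1] to [1 + y] bounds the integral above, and the one from
    [y] to [1] excludes the value 0. *)
Lemma gamma_integral_fin_pos (x : R) : 0 < x -> (0 < gamma_integral x < +oo)%E.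
Proof.
have step (y : R) : 0 < y ->
    (0 < gamma_integral (y + 1) < +oo)%E = (0 < gamma_integral y < +oo)%E.
  move=> y0; rewrite gamma_integralS//.
  have := gamma_integral_ge0 y; case: (gamma_integral y) => [r| |]//.
    by rewrite lee_fin => r0; rewrite -EFinM !lte_fin !ltry !andbT pmulr_rgt0.
  by rewrite gt0_muley// ltxx !andbF.
have base (y : R) : 0 < y <= 1 -> (0 < gamma_integral y < +oo)%E.
  move=> /andP[y0 y1]; rewrite -step//.
  have y01 : 0 <= y <= 1 by rewrite ltW.
  rewrite [(_ < +oo)%E](le_lt_trans (y := 1%E)) ?ltry// ?andbT; last first.
    rewrite addrC (le_trans (gamma_integral_wendel _ y01))//.
    by rewrite gamma_integral1 powR1 mule1.
  rewrite gamma_integralS// lt_neqAle eq_sym mule_eq0 negb_or eqe gt_eqF//=.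
  rewrite mule_ge0 ?lee_fin ?gamma_integral_ge0 ?(ltW y0)// andbT.
  apply/eqP => y0'; have := @gamma_integral_wendel y (1 - y) y0.
  rewrite subrKC gamma_integral1 y0' mule0 subr_ge0 y1 lerBlDr lerDl ltW//.
  by rewrite lee_fin ler10 => /(_ isT).
move=> x0; have : exists n : nat, x <= n.+1%:R.
  by exists (Num.trunc x); rewrite ltW// truncnS_gt.
case=> n; elim: n x x0 => [x x0 x1|n ih x x0 xn]; first by rewrite base// x0.
have [x1|x1] := leP x 1; first by rewrite base// x0.
by rewrite -(subrK 1 x) step ?subr_gt0// ih ?subr_gt0// lerBlDr natr1.
Qed.

Lemma GammaE (x : R) : 0 < x -> (Gamma x)%:E = gamma_integral x.
Proof.
move=> /gamma_integral_fin_pos /andP[g0 gy].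
by rewrite /Gamma /Rintegral fineK// ge0_fin_numE// ltW.
Qed.

Lemma Gamma_gt0 (x : R) : 0 < x -> 0 < Gamma x.
Proof.
by move=> x0; rewrite -lte_fin GammaE//; case/andP: (gamma_integral_fin_pos x0).
Qed.

Lemma GammaS (x : R) : 0 < x -> Gamma (x + 1) = x * Gamma x.
Proof.
by move=> x0; apply: EFin_inj;
  rewrite EFinM !GammaE ?addr_gt0// gamma_integralS.
Qed.

Lemma Gamma_wendel (x h : R) : 0 < x -> 0 <= h <= 1 ->
  Gamma (x + h) <= x `^ h * Gamma x.
Proof.
move=> x0 h01; have h0 : 0 <= h by case/andP: h01.
by rewrite -lee_fin EFinM !GammaE ?ltr_wpDr// gamma_integral_wendel.
Qed.

(** * Increments of [ln Gamma] *)

Lemma lnGammaS (x : R) : 0 < x -> ln (Gamma (x + 1)) = ln (Gamma x) + ln x.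
Proof. by move=> x0; rewrite GammaS// lnM ?posrE ?Gamma_gt0// addrC. Qed.

Lemma lnGamma_upper (x h : R) : 0 < x -> 0 <= h <= 1 ->
  ln (Gamma (x + h)) - ln (Gamma x) <= h * ln x.
Proof.
move=> x0 /[dup] h01 /andP[h0 _].
rewrite lerBlDr -ln_powR -lnM ?posrE ?powR_gt0 ?Gamma_gt0//.
by rewrite ler_ln ?posrE ?mulr_gt0 ?powR_gt0 ?Gamma_gt0 ?ltr_wpDr//
  Gamma_wendel.
Qed.

Lemma ln_increment_upper (x h : R) : 0 < x -> 0 <= h -> ln (x + h) - ln x
  <= h / x.
Proof.
move=> x0 h0; rewrite -ln_div ?posrE ?ltr_wpDr//.
rewrite mulrDl divff ?gt_eqF//; apply: le_ln1Dx.
by rewrite (@lt_le_trans _ _ 0) ?divr_ge0// ltW.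
Qed.

Lemma ln_increment_lower (x h : R) : 0 < x -> 0 <= h ->
  h / (x + h) <= ln (x + h) - ln x.
Proof.
move=> x0 h0; have xh0 : 0 < x + h by rewrite ltr_wpDr.
rewrite -lerN2 opprB -ln_div ?posrE//.
have -> : x / (x + h) = 1 + - (h / (x + h)) by field; rewrite gt_eqF.
apply: le_ln1Dx; rewrite ltrN2 ltr_pdivrMr// mul1r; lra.
Qed.

(** Apply the upper bound from [x + h] to [x + 1] and subtract it from the functional equation. The
    loss [h / x] is only linear in [h], but it vanishes far to the right. *)
Lemma lnGamma_lower (x h : R) : 0 < x -> 0 <= h <= 1 ->
  h * ln x - h / x <= ln (Gamma (x + h)) - ln (Gamma x).
Proof.
move=> x0 /andP[h0 h1]; have xh0 : 0 < x + h by rewrite ltr_wpDr.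
have := @lnGamma_upper (x + h) (1 - h) xh0.
rewrite subr_ge0 h1 lerBlDr lerDl h0 => /(_ isT).
rewrite -addrA subrKC lnGammaS//.
have := ln_increment_upper x0 h0.
have : 0 <= h * (ln (x + h) - ln x).
  by rewrite mulr_ge0// subr_ge0 ler_ln ?posrE// lerDl.
by move: (ln (Gamma (x + h))) (ln (Gamma x)) => g1 g2; lra.
Qed.

End gamma_function.

(** * The digamma function at positive integers *)

Section digamma_nat.
Context {R : realType}.

Lemma ln_le_harmonic n : ln n.+1%:R <= series harmonic n :> R.
Proof.
rewrite /series/=; elim: n => [|n ih]; first by rewrite ln1 big_geq.
rewrite big_nat_recr//=.
have := @ln_increment_upper R n.+1%:R 1 (ltr0Sn _ _) ler01.
by rewrite natr1 div1r lerBlDl => /le_trans; apply; rewrite lerD2r.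
Qed.

(** From index 1 on the sequence decreases and is nonnegative. The shift skips index 0, where
    [ln 0 = 0] gives the term 0, below the next term 1. *)
Lemma cvg_euler_mascheroni :
  (fun n => series harmonic n - ln n%:R : R) @ \oo --> euler_mascheroni R.
Proof.
have : cvgn (fun n => series harmonic n.+1 - ln n.+1%:R : R).
  apply: nonincreasing_is_cvgn.
    apply/nonincreasing_seqP => n.
    rewrite /series/= [in leLHS]big_nat_recr//=.
    have := @ln_increment_lower R n.+1%:R 1 (ltr0Sn _ _) ler01.
    rewrite natr1 div1r.
    by move: (\sum_(_ <= _ < _) _) (_^-1) (ln _) (ln _) => s i a b; lra.
  exists 0 => _ [n _ <-]; rewrite subr_ge0 (le_trans (ln_le_harmonic n))//.
  by rewrite /series/= [leRHS]big_nat_recr//= lerDl.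
by move=> /cvgP/cvg_ex[l];
  rewrite /= (cvg_shiftS (fun n => series harmonic n - ln n%:R)) => /cvgP.
Qed.

(** The sharper bound [2 - 1 / n] telescopes; what matters later is a bound uniform in [n]. *)
Lemma sum_inv_sqr_le n : \sum_(0 <= k < n) (k.+1%:R ^+ 2)^-1 <= 2 :> R.
Proof.
have [->|n0] := posnP n; first by rewrite big_geq.
suff h m : \sum_(0 <= k < m.+1) (k.+1%:R ^+ 2)^-1 <= 2 - m.+1%:R^-1 :> R.
  by rewrite -(prednK n0) (le_trans (h _))// gerBl.
elim: m => [|m ih]; first by rewrite big_nat1 expr1n invr1; lra.
rewrite big_nat_recr//= (le_trans (lerD ih (lexx _)))//.
rewrite -addrA lerD2l -(@natr1 R m.+1).
move: (ltr0Sn R m); move: (m.+1%:R : R) => a a0.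
rewrite -subr_ge0.
have -> : - (a + 1)^-1 - (- a^-1 + ((a + 1) ^+ 2)^-1) = (a * (a + 1) ^+ 2)^-1.
  have a10 : a + 1 != 0 by rewrite gt_eqF ?addr_gt0.
  by field; rewrite a10 gt_eqF.
by rewrite invr_ge0 mulr_ge0 ?exprn_ge0 ?addr_ge0// ltW.
Qed.

(** Terms differ by [h / ((y + k) * (y + h + k))], and the hypotheses make this denominator at least
    [(k + 1)^2 / 2]. Hence an error linear in [h], uniformly in [n]. *)
Lemma sum_inv_shift_le (y h : R) n : 2^-1 <= y -> 0 <= h -> 1 <= y + h ->
  \sum_(0 <= k < n) (y + k%:R)^-1 <= \sum_(0
    <= k < n) (y + h + k%:R)^-1 + 4 * h.
Proof.
move=> y2 h0 yh1.
apply: (@le_trans _ _ (\sum_(0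
  <= k < n) ((y + h + k%:R)^-1 + 2 * h * (k.+1%:R ^+ 2)^-1))).
  apply: ler_sum => k _; rewrite -(@natr1 R k).
  have k0 : 0 <= k%:R :> R by [].
  set j : R := k%:R in k0 *.
  have p1 : 0 < y + j by lra.
  have p2 : 0 < y + h + j by lra.
  have p3 : 0 < j + 1 by lra.
  rewrite -lerBlDl.
  have -> : (y + j)^-1 - (y + h + j)^-1 = h * ((y + j) * (y + h + j))^-1.
    by field; rewrite !gt_eqF.
  rewrite (mulrC 2) -mulrA ler_wpM2l//.
  have -> : 2 / (j + 1) ^+ 2 = ((j + 1) ^+ 2 / 2)^-1.
    by field; rewrite gt_eqF.
  rewrite lef_pV2 ?posrE; [nra|exact: mulr_gt0|].
  by rewrite divr_gt0 ?exprn_gt0.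
rewrite big_split/= lerD2l -mulr_sumr.
rewrite (_ : 4 * h = 2 * h * 2); last by ring.
by rewrite ler_wpM2l ?mulr_ge0// sum_inv_sqr_le.
Qed.

Lemma lnGammaD (y : R) n : 0 < y ->
  ln (Gamma (y + n%:R)) = ln (Gamma y) + \sum_(0 <= k < n) ln (y + k%:R).
Proof.
move=> y0; elim: n => [|n ih]; first by rewrite big_geq// !addr0.
by rewrite big_nat_recr//= addrA -ih -natr1 addrA lnGammaS// ltr_wpDr.
Qed.

(** The functional equation, used [n] times at [y] and at [y + h], moves the increment to [y + n],
    where the bounds on it are sharp. *)
Lemma lnGamma_increment (y h : R) n : 0 < y -> 0 <= h ->
  ln (Gamma (y + h)) - ln (Gamma y) =
  ln (Gamma (y + n%:R + h)) - ln (Gamma (y + n%:R))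
  - \sum_(0 <= k < n) (ln (y + k%:R + h) - ln (y + k%:R)).
Proof.
move=> y0 h0; rewrite sumrB.
under eq_bigr do rewrite addrAC.
rewrite [y + n%:R + h]addrAC (lnGammaD n y0) (lnGammaD n (ltr_wpDr h0 y0)).
move: (\sum_(_ <= _ < _) _) (\sum_(_ <= _ < _) _) => s1 s2.
by move: (ln (Gamma (y + h))) (ln (Gamma y)) => g1 g2; ring.
Qed.

Lemma lnGamma_increment_upper (y h : R) n : 0 < y -> 0 <= h <= 1 ->
  ln (Gamma (y + h)) - ln (Gamma y) <=
  h * (ln (y + n%:R) - \sum_(0 <= k < n) (y + h + k%:R)^-1).
Proof.
move=> y0 /[dup] h01 /andP[h0 h1];
  rewrite (lnGamma_increment n)// mulrBr lerB//.
  by apply: lnGamma_upper => //; rewrite ltr_wpDr.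
rewrite mulr_sumr; apply: ler_sum => k _; rewrite addrAC.
by apply: ln_increment_lower => //; rewrite ltr_wpDr.
Qed.

Lemma lnGamma_increment_lower (y h : R) n : 2^-1 <= y -> 0 <= h <= 1 ->
  h * (ln (y + n%:R) - 2 * harmonic n - \sum_(0 <= k < n) (y + k%:R)^-1) <=
  ln (Gamma (y + h)) - ln (Gamma y).
Proof.
move=> y2 /[dup] h01 /andP[h0 h1]; have y0 : 0 < y by lra.
rewrite (lnGamma_increment n)// mulrBr lerB//.
  apply: le_trans (lnGamma_lower _ h01); last by rewrite ltr_wpDr.
  (* Since [y] is at least 1/2, the loss [1 / (y + n)] is at most [2 / (n + 1)], that is
     [2 * harmonic n]. *)
  rewrite mulrBr lerD2l lerN2 ler_wpM2l//= -[leRHS]invrK lef_pV2 ?posrE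
    ?invr_gt0 ?mulr_gt0 ?ltr_wpDr//.
  rewrite invfM invrK -(@natr1 R n); have : 0 <= n%:R :> R by []. lra.
rewrite mulr_sumr; apply: ler_sum => k _.
by apply: ln_increment_upper => //; rewrite ltr_wpDr.
Qed.

Lemma sum_inv_addn m n :
  \sum_(0 <= k < n) (m.+1%:R + k%:R)^-1
    = series harmonic (m + n)%N - series harmonic m :> R.
Proof.
rewrite /series/= [X in _ = X - _](@big_cat_nat _ _ _ m)/= ?leq_addr//.
rewrite [RHS]addrC addrA addNr add0r (addnC m n) -{2}[m]add0n big_addn addnK.
by apply: eq_bigr => k _; rewrite -natrD addSn addnC.
Qed.

(* The case [y = m.+1] gives the right derivative of [ln Gamma] at [m.+1], the
   case [y + h = m.+1] the left one. *)
Lemma lnGamma_increment_near (m : nat) (y h : R) :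
  2^-1 <= y -> 0 <= h <= 1 -> y <= m.+1%:R <= y + h ->
  `|ln (Gamma (y + h)) - ln (Gamma y) - h * (series harmonic m -
    euler_mascheroni R)|
  <= 6 * h ^+ 2.
Proof.
move=> y2 /[dup] h01 /andP[h0 h1] /andP[yL Lh]; set D := _ - ln (Gamma y).
have y0 : 0 < y by lra.
have L1 : 1 <= m.+1%:R :> R by rewrite ler1n.
(* [w n] is the bracket of the two increment bounds with [y] and [y + h] replaced by [m.+1]. The
   replacement costs at most [4 * h] from the sums and [2 * h] from the logarithm; the outer factor
   [h] makes the error quadratic, with constant 6. *)
pose w n : R := ln (m.+1%:R + n%:R) - (series harmonic (m + n)%N -
  series harmonic m).
have wc : w @ \oo --> series harmonic m - euler_mascheroni R.
  (* The harmonic sum is one term short of the argument of [ln]; the missing term [harmonic (n + m)]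
     tends to 0. *)
  have -> : w = fun n => series harmonic m
      - ((series harmonic (n + m.+1)%N - ln (n + m.+1)%:R) -
        harmonic (n + m)%N).
    apply/funext => n; rewrite /w -natrD addSn addnC addnS.
    rewrite /series/= [in RHS]big_nat_recr//=; ring.
  apply: cvgB; first exact: cvg_cst.
  rewrite -[X in _ --> X]subr0; apply: cvgB.
    have := cvg_euler_mascheroni; rewrite -(cvg_shiftn m.+1); exact.
  by have := @cvg_harmonic R; rewrite -(cvg_shiftn m); exact.
have lnU n : ln (y + n%:R) <= ln (m.+1%:R + n%:R).
  by rewrite ler_ln ?posrE ?ltr_wpDr// lerD2r.
have lnL n : ln (m.+1%:R + n%:R) - 2 * h <= ln (y + n%:R).
  have yn0 : 0 < y + n%:R by rewrite ltr_wpDr.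
  have := ln_increment_upper yn0 h0.
  have : ln (m.+1%:R + n%:R) <= ln (y + n%:R + h).
    by rewrite ler_ln ?posrE ?ltr_wpDr// addrAC lerD2r.
  have : h / (y + n%:R) <= 2 * h.
    rewrite mulrC ler_wpM2r// invf_ple ?posrE// (le_trans y2)// lerDl//.
  lra.
have S1 n : \sum_(0 <= k < n) (m.+1%:R + k%:R)^-1 <= \sum_(0
  <= k < n) (y + k%:R)^-1 :> R.
  apply: ler_sum => k _; rewrite lef_pV2 ?posrE ?ltr_wpDr// lerD2r//.
have S2 n : \sum_(0 <= k < n) (y + h + k%:R)^-1 <= \sum_(0
  <= k < n) (m.+1%:R + k%:R)^-1 :> R.
  apply: ler_sum => k _; rewrite lef_pV2 ?posrE ?ltr_wpDr// lerD2r//.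
have S3 n := sum_inv_shift_le n y2 h0 (le_trans L1 Lh).
have U n : D <= h * (w n + 4 * h).
  rewrite (le_trans (lnGamma_increment_upper n y0 h01))// ler_wpM2l//.
  move: (lnU n) (S1 n) (S3 n); rewrite sum_inv_addn /w; lra.
have L n : h * (w n - 2 * harmonic n - 6 * h) <= D.
  rewrite (le_trans _ (lnGamma_increment_lower n y2 h01))// ler_wpM2l//.
  move: (lnL n) (S2 n) (S3 n); rewrite sum_inv_addn /w; lra.
set c := _ - _ in wc *.
have Uc : D <= h * (c + 4 * h).
  have : h * (w n + 4 * h) @[n --> \oo] --> h * (c + 4 * h).
    by apply: cvgMr; apply: cvgD => //; exact: cvg_cst.
  by move=> /cvgr_to_ge; apply; exact: nearW.
have Lc : h * (c - 6 * h) <= D.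
  have : h * (w n - 2 * harmonic n - 6 * h) @[n --> \oo] --> h * (c - 2 * 0 -
    6 * h).
    apply: cvgMr; apply: cvgB; last exact: cvg_cst.
    by apply: cvgB => //; apply: cvgMr; exact: cvg_harmonic.
  by rewrite mulr0 subr0 => /cvgr_to_le; apply; exact: nearW.
rewrite ler_norml; nra.
Qed.

Lemma is_derive_lnGamma_nat (m : nat) :
  is_derive (m.+1%:R : R) 1 (fun x
    => ln (Gamma x)) (series harmonic m - euler_mascheroni R).
Proof.
set c := _ - _; set L : R := m.+1%:R.
have L1 : 1 <= L by rewrite ler1n.
have cv : h^-1 *: (((fun x
  => ln (Gamma x)) \o shift L) (h *: 1) -
    ln (Gamma L)) @[h --> 0^'] --> (c : R^o).
  apply/cvgrPdist_le => e e0; near=> h.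
  have h0 : h != 0 by near: h; exact: nbhs_dnbhs_neq.
  (* This keeps [L + h] at least 1/2 when [h] is negative. *)
  have h2 : `|h| <= 2^-1.
    by near: h; apply: dnbhs0_le.
  have he : 6 * `|h| <= e.
    rewrite mulrC -ler_pdivlMr//; near: h; apply: dnbhs0_le.
    by rewrite divr_gt0.
  rewrite /= scaler1 [h + L]addrC -[h^-1 *: _]/(h^-1 * _).
  rewrite -[X in `|X - _|](mulKf h0) -mulrBr normrM normfV.
  rewrite distrC ler_pdivrMl ?normr_gt0// (le_trans _ (ler_wpM2l
    (normr_ge0 _) he))//.
  rewrite mulrCA -expr2.
  have [hp|hn] := ltP 0 h.
    rewrite gtr0_norm// in h2 *.
    apply: lnGamma_increment_near; lra.
  (* For negative [h] the increment runs from [L + h] up to [L], with step [- h]. *)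
  have hn' : h < 0 by rewrite lt_neqAle h0.
  rewrite ltr0_norm// in h2 *.
  have := @lnGamma_increment_near m (L + h) (- h).
  rewrite addrK -/L -/c => H.
  rewrite -normrN; apply: le_trans (H _ _ _); [|lra..].
  by rewrite le_eqVlt; apply/orP; left; apply/eqP; congr (`|_|); ring.
by split; [exact: cvgP cv|exact: cvg_lim cv].
Unshelve. all: by end_near. Qed.

Lemma digamma_nat (m : nat) :
  digamma (m.+1%:R : R) = series harmonic m - euler_mascheroni R.
Proof.
set c := _ - _; set L : R := m.+1%:R.
have L0 : 0 < L by [].
have : is_derive L 1 (@Gamma R) (Gamma L * c).
  apply: (@near_eq_is_derive _ _ _ (expR \o (fun x => ln (Gamma x)))).
    near=> x; rewrite /= lnK// posrE Gamma_gt0//.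
    by near: x; exact: lt_nbhsr.
  apply: is_derive1_comp; last exact: is_derive_lnGamma_nat.
  have := is_derive_expR (ln (Gamma L)); rewrite lnK// posrE; exact: Gamma_gt0.
move=> [_ E]; rewrite /digamma derive1E E mulrC mulKf// gt_eqF//.
exact: Gamma_gt0.
Unshelve. all: by end_near. Qed.

End digamma_nat.

(** * The maximum of independent branches *)

Section random_variables.
Context d (T : measurableType d) (R : realType) (P : probability T R).
Notation mu := (@lebesgue_measure R).

Lemma max_snr_ge0 L (X : 'I_L -> {RV P >-> R}) t : 0 <= max_snr X t.
Proof. exact: bigmax_ge_id. Qed.

(** The maximum is at most [x] exactly when all branches and the default 0 are; [0 <= x] takes care
    of the default, and independence over the full index set gives equal factors. *)
Lemma cdf_max_snr L (X : 'I_L -> {RV P >-> R}) (x F : R) :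
  mutually_independent X -> 0 <= x -> (forall l, cdf (X l) x = F%:E) ->
  cdf (sc_snr X) x = (F ^+ L)%:E.
Proof.
move=> indep x0 XF.
have := indep [set: 'I_L]%SET (fun=> `]-oo, x]%classic)
  (fun=> measurable_itv _).
rewrite (_ : \bigcap_(i in _) _ = max_snr X @^-1` `]-oo, x]); last first.
  apply/seteqP; split => t /=; rewrite ?in_itv/=.
    move=> Xt; apply/bigmax_leP; split => // i _.
    by have := Xt i; rewrite /= in_itv/=; apply; rewrite inE.
  by move=> /bigmax_leP[_ Xt] i _; rewrite /= in_itv/=; exact: Xt.
rewrite /cdf /distribution /pushforward /= => ->.
under eq_bigr => i _ do rewrite [P _](XF i).
by rewrite prodEFin prodr_const cardsT card_ord.
Qed.

(** A density makes the law of [X] absolutely continuous, and [f] agrees almost everywhere with the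
    Radon-Nikodym derivative because both have the same integrals over measurable sets. *)
Lemma integral_pdf (X : {RV P >-> R}) (f : R -> R) (g : R -> \bar R) :
  is_pdf X f -> measurable_fun setT g -> (forall x, 0 <= g x)%E ->
  (\int[mu]_x (g x * (f x)%:E) = \int[P]_t g (X t))%E.
Proof.
move=> [mf f0 fX] mg g0.
(* [distribution P X] is a measure for the default measurable structure on [R],
   whereas the Lebesgue measure lives on [measurableTypeR R]. *)
have mX : measurable_fun setT (X : T -> measurableTypeR R).
  by move=> _ A mA; exact: (@measurable_funPT _ _ _ _ X measurableT A mA).
pose X' : {mfun T >-> measurableTypeR R} :=
  HB.pack (X : T -> measurableTypeR R)
    (isMeasurableFun.Build _ _ T (measurableTypeR R) (X : T ->
      measurableTypeR R) mX).
pose nu : {finite_measure set (measurableTypeR R) -> \bar R} :=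
  distribution P X'.
have nuE A : measurable A -> nu A = (\int[mu]_(x in A) (f x)%:E)%E by exact: fX.
have numu : nu `<< mu.
  apply/null_content_dominatesP => A mA A0.
  rewrite nuE//; apply: null_set_integral => //.
  by apply/measurable_EFinP; exact: measurable_funTS.
rewrite -[RHS](ge0_integral_distribution X')//.
rewrite -(Radon_Nikodym_SigmaFinite.change_of_variables numu)//.
have mRN := measurable_int _ (Radon_Nikodym_SigmaFinite.f_integrable numu).
apply: ae_eq_integral => //.
- by apply: emeasurable_funM => //; exact/measurable_EFinP.
- exact: emeasurable_funM.
- apply: ae_eqe_mul2l; apply: ae_eq_sym; apply: integral_ae_eq => //.
  + exact: Radon_Nikodym_SigmaFinite.f_integrable.
  + exact/measurable_EFinP.
  + by move=> E _ mE; rewrite -Radon_Nikodym_SigmaFinite.f_integral// -nuE.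
Qed.

Lemma ge0_integral_tail (X : {RV P >-> R}) (g : R -> R) :
  measurable_fun setT g -> (forall x, 0 <= g x) ->
  (\int[P]_t (g (X t))%:E =
   \int[mu]_(r in `[0%R, +oo[) P [set t | (r < g (X t))%R])%E.
Proof.
move=> mg g0.
have mgX : measurable_fun setT (g \o X) by exact: measurableT_comp.
pose Y : {RV P >-> R} :=
  HB.pack (g \o X) (isMeasurableFun.Build _ _ T R (g \o X) mgX).
have := @ge0_expectation_ccdf _ _ _ P Y (fun t => g0 (X t)).
rewrite expectation_def => ->; apply: eq_integral => r _.
by congr (P _); apply/seteqP; split => t /=; rewrite in_itv/= andbT.
Qed.

End random_variables.

(** * Log-logistic distributions *)

Section logistic.
Context {R : realType}.
Notation mu := (@lebesgue_measure R).

(** A primitive of [(1 - x ^+ m.+1) / (x * (1 - x))] on [0 < x < 1]; its value at 1 is the harmonic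
    number [series harmonic m]. *)
Definition ln_partial_sum (m : nat) (x : R) : R :=
  ln x + \sum_(0 <= k < m) x ^+ k.+1 / k.+1%:R.

Lemma is_derive_ln_partial_sum m (x : R) : 0 < x ->
  is_derive x 1 (ln_partial_sum m) (x^-1 + \sum_(0 <= k < m) x ^+ k).
Proof.
move=> x0; elim: m => [|m ih].
  rewrite big_geq// addr0; apply: near_eq_is_derive (is_derive1_ln x0).
  by near=> y; rewrite /ln_partial_sum big_geq// addr0.
rewrite big_nat_recr//= addrA.
apply: (@near_eq_is_derive _ _ _ (ln_partial_sum m + (m.+1%:R^-1 \*: (fun y
  => y ^+ m.+1)))).
  near=> y; rewrite /ln_partial_sum big_nat_recr//= addrA fctE.
  by congr (_ + _); rewrite /= mulrC.
have d : is_derive x 1 (fun y : R => y ^+ m.+1) (m.+1%:R * x ^+ m).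
  by split; [exact: exprn_derivable|rewrite exp_derive/= [LHS]mulr1].
have d' : is_derive x 1 (m.+1%:R^-1 \*: (fun y : R
  => y ^+ m.+1)) (m.+1%:R^-1 *: (m.+1%:R * x ^+ m)).
  exact: is_deriveZ.
apply: is_derive_eq (is_deriveD ih d') _.
by rewrite [X in _ + X]mulrA mulVf// mul1r.
Unshelve. all: by end_near. Qed.

Definition logistic (c b r : R) : R := (1 + c * expR (- (b * r)))^-1.

Lemma logistic_itv (c b r : R) : 0 < c -> 0 < logistic c b r < 1.
Proof.
move=> c0; have h : 0 < c * expR (- (b * r)) by rewrite mulr_gt0 ?expR_gt0.
have h1 : 0 < 1 + c * expR (- (b * r)) by rewrite addr_gt0.
by rewrite /logistic invr_gt0 invf_lt1// h1 ltrDl.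
Qed.

Lemma is_derive_logistic (c b r : R) : 0 < c ->
  is_derive r 1 (logistic c b) (b * (logistic c b r * (1 - logistic c b r))).
Proof.
move=> c0; have h : 1 + c * expR (- (b * r)) != 0.
  by rewrite gt_eqF// addr_gt0// mulr_gt0 ?expR_gt0.
have d : is_derive r 1 (fun r
  => 1 + c * expR (- (b * r))) (- (b * c * expR (- (b * r)))).
  apply: is_derive_eq.
  rewrite add0r mul1r -[b%:A]/(b * 1) mulr1 -[_ *: _]/(_ * _).
  by move: (expR _) => e; ring.
apply: is_derive_eq (@is_deriveV _ (fun r
  => 1 + c * expR (- (b * r))) r _ 1 h d) _.
rewrite -[_ *: _]/(_ * _) /logistic.
by move: (expR _) h => e h; field.
Qed.

Lemma cvg_logistic (c b : R) : 0 < b -> logistic c b r @[r --> +oo] --> (1 : R).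
Proof.
move=> b0; rewrite -[X in _ --> X]invr1; apply: cvgV; first exact: oner_neq0.
rewrite -[X in _ --> X](addr0 1); apply: cvgD; first exact: cvg_cst.
rewrite -[X in _ --> X](mulr0 c); apply: cvgMr.
apply: (cvg_comp _ _ _ (@cvgr_expR R)).
by apply: gt0_cvgMry => //; exact: cvg_id.
Qed.

(** The logistic equation [G' = b * G * (1 - G)] cancels the denominator in the derivative of
    [ln_partial_sum m]. The limits are [G = 1] at infinity and [G = (1 + c)^-1] at 0. *)
Lemma integral_logistic_tail (c b : R) m : 0 < c -> 0 < b ->
  (\int[mu]_(r in `[0%R, +oo[) (1 - logistic c b r ^+ m.+1)%:E =
   (b^-1 * (series harmonic m - ln_partial_sum m (1 + c)^-1))%:E)%E.
Proof.
move=> c0 b0.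
pose F (r : R) : R := b^-1 * ln_partial_sum m (logistic c b r).
pose f (r : R) : R := 1 - logistic c b r ^+ m.+1.
have dF (r : R) : is_derive r 1 F (f r).
  have /andP[g0 g1] := logistic_itv b r c0.
  have d := is_derive1_comp (is_derive_ln_partial_sum m g0)
    (is_derive_logistic b r c0).
  apply: is_derive_eq (is_deriveZ b^-1 d) _.
  rewrite -[_ *: _]/(_ * _) /f.
  have -> : logistic c b r ^+ m.+1 = 1 - (1 - logistic c b r) * (\sum_(0
    <= k < m.+1) logistic c b r ^+ k).
    by rewrite big_mkord -[1 - logistic c b r]opprB mulNr opprK -subrX1 subrKC.
  rewrite big_nat_recl//= expr0 opprB subrKC.
  under [in RHS]eq_bigr do rewrite exprS.
  rewrite -mulr_sumr; set g := logistic c b r in g0 *.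
  move: (\sum_(_ <= _ < _) _) => S; field.
  by rewrite !gt_eqF.
have F0 : F 0 = b^-1 * ln_partial_sum m (1 + c)^-1.
  by rewrite /F /logistic mulr0 oppr0 expR0 mulr1.
have cF (r : R) : {for r, continuous F}.
  by apply/differentiable_continuous/derivable1_diffP; have [] := dF r.
rewrite (@ge0_continuous_FTC2y _ f F 0 (b^-1 * series harmonic m)).
- by rewrite F0 -EFinB -mulrBr.
- move=> r _; have /andP[g0 g1] := logistic_itv b r c0.
  by rewrite /f subr_ge0 exprn_ile1// ltW.
- apply: continuous_subspaceT => r.
  apply: cvgB; first exact: cvg_cst.
  apply: (@continuous_comp _ _ _ (logistic c b) (fun x => x ^+ m.+1));
    last exact: exprn_continuous.
  apply/differentiable_continuous/derivable1_diffP.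
  by have [] := is_derive_logistic b r c0.
- apply: cvgMr.
  have -> : series harmonic m = ln_partial_sum m 1 :> R.
    rewrite /ln_partial_sum ln1 add0r /series/=; apply: eq_bigr => k _.
    by rewrite expr1n div1r.
  apply: (cvg_comp _ _ (cvg_logistic c b0)).
  apply/differentiable_continuous/derivable1_diffP.
  by have [] := is_derive_ln_partial_sum m (ltr01 : 0 < (1 : R)).
- by move=> r _; have [] := dF r.
- exact/cvg_at_right_filter/cF.
- by move=> r _; rewrite derive1E; have [_ ->] := dF r.
Qed.

End logistic.

(** * Expectation of the positive part of the logarithm *)

Section loglogistic_maximum.
Context d (T : measurableType d) (R : realType) (P : probability T R).

Lemma loglogistic_cdf_expR (s b N r : R) : 0 < s -> 0 < N ->
  loglogistic_cdf s b (N * expR r) = logistic ((N / s) `^ (- b)) b r.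
Proof.
move=> s0 N0; rewrite /loglogistic_cdf /logistic mulrAC.
by rewrite (@powRM _ (N / s) (expR r)) ?expR_ge0 ?divr_ge0 ?ltW// -expRM mulrN
  (mulrC r).
Qed.

(** For [r >= 0] the event that the positive part exceeds [r] is [X > N * expR r], a positive
    threshold at which the distribution function is known. *)
Lemma expectation_ln_pos_part (X : {RV P >-> R}) (s b N : R) m :
  0 < s -> 0 < b -> 0 < N -> (forall t, 0 <= X t) ->
  (forall x, 0 < x -> cdf X x = (loglogistic_cdf s b x ^+ m.+1)%:E) ->
  (\int[P]_t (Num.max (ln (X t / N)) 0)%:E =
   (b^-1 * (series harmonic m
            - ln_partial_sum m (1 + (N / s) `^ (- b))^-1))%:E)%E.
Proof.
move=> s0 b0 N0 X0 XF.
rewrite (@ge0_integral_tail _ _ _ P X (fun x => Num.max (ln (x / N)) 0));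
  last 2 first.
- apply: measurable_maxr => //; apply: measurableT_comp;
  first exact: measurable_ln.
  exact: mulrr_measurable.
- by move=> x; rewrite le_max lexx orbT.
rewrite -integral_logistic_tail ?powR_gt0 ?divr_gt0//.
apply: eq_integral => r; rewrite inE/= in_itv/= andbT => r0.
transitivity (ccdf X (N * expR r)).
  (* The case [X t = 0] is separate: there [ln 0 = 0], so neither event occurs. *)
  congr (P _); apply/seteqP; split => t /=;
    rewrite in_itv/= andbT lt_max (ltNge r 0) r0 orbF;
    have := X0 t; rewrite le_eqVlt => /predU1P[<-|Xt].
  - by rewrite mul0r ln0// ltNge r0.
  - rewrite -[X in X < _](expRK r) ltr_ln ?posrE ?expR_gt0 ?divr_gt0//.
    by rewrite ltr_pdivlMr// mulrC.
  - by move=> /lt_trans/(_ (mulr_gt0 N0 (expR_gt0 r))); rewrite ltxx.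
  - rewrite -[X in _ -> X < _](expRK r) ltr_ln ?posrE ?expR_gt0 ?divr_gt0//.
    by rewrite ltr_pdivlMr// mulrC.
by rewrite ccdf_1_cdf XF ?mulr_gt0 ?expR_gt0// loglogistic_cdf_expR.
Qed.

End loglogistic_maximum.

(** * The ergodic capacity *)

Section capacity_bounds.
Context d (T : measurableType d) (R : realType) (P : probability T R).
Notation mu := (@lebesgue_measure R).

(** The argument is [v / (1 + v)]: its logarithm loses [ln (1 + v) <= v], and each of the [m] terms
    of the sum lies between 0 and [v]. *)
Lemma ln_partial_sum_bounds m (v : R) : 0 < v ->
  ln v - v <= ln_partial_sum m (1 + v^-1)^-1 <= ln v + m%:R * v.
Proof.
move=> v0; have v1 : 0 < 1 + v by rewrite addr_gt0.
have -> : (1 + v^-1)^-1 = v / (1 + v).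
  by field; rewrite !gt_eqF//= addrC.
set G := v / (1 + v).
have G0 : 0 <= G by rewrite divr_ge0 ?ltW.
have G1 : G <= 1 by rewrite ler_pdivrMr// mul1r lerDr.
have Gv : G <= v by rewrite ler_pdivrMr// ler_peMr ?ltW// ltrDl.
rewrite /ln_partial_sum ln_div ?posrE//.
have l0 : 0 <= ln (1 + v) by rewrite ln_ge0// lerDl ltW.
have l1 : ln (1 + v) <= v by rewrite le_ln1Dx// (lt_trans _ v0).
have s0 : 0 <= \sum_(0 <= k < m) G ^+ k.+1 / k.+1%:R.
  by apply: sumr_ge0 => k _; rewrite divr_ge0 ?exprn_ge0.
have s1 : \sum_(0 <= k < m) G ^+ k.+1 / k.+1%:R <= m%:R * v.
  apply: (@le_trans _ _ (\sum_(0 <= k < m) v)); last first.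
    by rewrite sumr_const_nat subn0 mulr_natl.
  apply: ler_sum => k _; rewrite ler_pdivrMr//.
  rewrite (@le_trans _ _ G)//; first by rewrite exprS ler_piMr ?exprn_ile1.
  by rewrite (le_trans Gv)// ler_peMr ?ler1n// ltW.
by apply/andP; split; lra.
Qed.

(** Monotonicity for [x <= N]; beyond [N], use [1 + x <= (1 + N) * (x / N)]. *)
Lemma ln1D_le (N x : R) : 0 < N -> 0 <= x ->
  ln (1 + x) <= ln (1 + N) + Num.max (ln (x / N)) 0.
Proof.
move=> N0 x0; have [xN|Nx] := leP x N.
  rewrite ler_wpDr ?le_max ?lexx ?orbT//.
  by rewrite ler_ln ?posrE ?lerD2l// (ltr_wpDr _ ltr01)// ltW.
have xp : 0 < x by exact: lt_trans Nx.
apply: (@le_trans _ _ (ln (1 + N) + ln (x / N))); last first.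
  by rewrite lerD2l le_max lexx.
rewrite -lnM ?posrE ?divr_gt0 ?addr_gt0//.
rewrite ler_ln ?posrE ?mulr_gt0 ?invr_gt0 ?addr_gt0//.
by rewrite mulrA ler_pdivlMr//; nra.
Qed.

Lemma le_ln1D (x : R) : 0 <= x -> Num.max (ln (x / 1)) 0 <= ln (1 + x).
Proof.
rewrite divr1 le_eqVlt => /predU1P[<-|x0];
  first by rewrite ln0// addr0 ln1 maxxx.
rewrite ge_max ler_ln ?posrE ?addr_gt0// lerDr ler01/=.
by rewrite ln_ge0// lerDl ltW.
Qed.

Lemma measurable_ln_pos_part (X : {RV P >-> R}) (N : R) :
  measurable_fun setT (fun t => (Num.max (ln (X t / N)) 0)%:E).
Proof.
apply/measurable_EFinP; apply: measurable_maxr => //.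
apply: measurableT_comp; first exact: measurable_ln.
by apply: measurable_funM.
Qed.

Lemma measurable_ln1D (X : {RV P >-> R}) :
  measurable_fun setT (fun t => (ln (1 + X t))%:E).
Proof.
apply/measurable_EFinP; apply: measurableT_comp; first exact: measurable_ln.
exact: measurable_funD.
Qed.

Section bounds.
Variables (X : {RV P >-> R}) (s b : R) (m : nat).
Hypotheses (s0 : 0 < s) (b0 : 0 < b) (X0 : forall t, 0 <= X t).
Hypothesis XF :
  forall x, 0 < x -> cdf X x = (loglogistic_cdf s b x ^+ m.+1)%:E.

Lemma expectation_ln1D_ge :
  ((b^-1 * series harmonic m + ln s - b^-1 * (m%:R * s `^ (- b)))%:E
   <= \int[P]_t (ln (1 + X t))%:E)%E.
Proof.
apply: (@le_trans _ _ (\int[P]_t (Num.max (ln (X t / 1)) 0)%:E)%E); last first.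
  apply: ge0_le_integral => //.
  - by move=> t _; rewrite lee_fin le_max lexx orbT.
  - exact: measurable_ln_pos_part.
  - exact: measurable_ln1D.
  - by move=> t _; rewrite lee_fin le_ln1D.
rewrite (expectation_ln_pos_part s0 b0 ltr01 X0 XF) lee_fin (powRN (1 / s)).
have v0 : 0 < (1 / s) `^ b by rewrite powR_gt0 ?divr_gt0.
have /andP[_ h] := ln_partial_sum_bounds m v0.
move: h; rewrite ln_powR div1r lnV ?posrE// => h.
have e : s^-1 `^ b = s `^ (- b).
  by rewrite powRN -[in LHS]powR_inv1 ?ltW// -powRrM mulN1r powRN.
rewrite e in h *; have := ler_wpM2l (_ : 0 <= b^-1) h.
rewrite invr_ge0 ltW// => /(_ isT).
have -> : b^-1 * (b * - ln s + m%:R * s `^ (- b))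
  = - ln s + b^-1 * (m%:R * s `^ (- b)).
  by field; rewrite gt_eqF.
rewrite mulrBr; lra.
Qed.

Lemma expectation_ln1D_le :
  (\int[P]_t (ln (1 + X t))%:E <=
   (b^-1 * series harmonic m + ln s + (s `^ (- 2^-1) +
     b^-1 * s `^ (- (2^-1 * b))))%:E)%E.
Proof.
pose N := s `^ 2^-1.
have N0 : 0 < N by exact: powR_gt0.
apply: (@le_trans _ _ (\int[P]_t ((ln (1 + N))%:E +
  (Num.max (ln (X t / N)) 0)%:E))%E).
  apply: ge0_le_integral => //.
  - by move=> t _; rewrite lee_fin ln_ge0// lerDl.
  - exact: measurable_ln1D.
  - by apply: emeasurable_funD => //; exact: measurable_ln_pos_part.
  - by move=> t _; rewrite -EFinD lee_fin ln1D_le.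
rewrite ge0_integralD//; last 3 first.
- by move=> t _; rewrite lee_fin ln_ge0// lerDl ltW.
- by move=> t _; rewrite lee_fin le_max lexx orbT.
- exact: measurable_ln_pos_part.
rewrite integral_cst//= probability_setT mule1.
rewrite (expectation_ln_pos_part s0 b0 N0 X0 XF) -EFinD lee_fin (powRN (N / s)).
have v0 : 0 < (N / s) `^ b by rewrite powR_gt0 ?divr_gt0.
have /andP[h _] := ln_partial_sum_bounds m v0.
have e : N / s = s `^ (- 2^-1).
  rewrite /N -[X in _ / X]powRr1 ?ltW// -powRB ?(gt_eqF s0) ?implybT//.
  by congr (_ `^ _); field.
have e2 : (N / s) `^ b = s `^ (- (2^-1 * b)) by rewrite e -powRrM mulNr.
move: h; rewrite ln_powR ln_div ?posrE// e2 => h.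
have l1 : ln (1 + N) - ln N <= s `^ (- 2^-1).
  rewrite powRN -/N -[N^-1]div1r [1 + N]addrC; apply: ln_increment_upper => //.
have := ler_wpM2l (_ : 0 <= b^-1) h.
rewrite invr_ge0 ltW// => /(_ isT).
have -> : b^-1 * (b * (ln N - ln s) - s `^ (- (2^-1 * b))) =
   ln N - ln s - b^-1 * s `^ (- (2^-1 * b)).
  by field; rewrite gt_eqF.
rewrite mulrBr; lra.
Qed.

End bounds.

Lemma ergodic_capacityE (X : {RV P >-> R}) (f : R -> R) :
  is_pdf X f -> (forall t, 0 <= X t) ->
  ergodic_capacity f = ((ln 2)^-1%:E * \int[P]_t (ln (1 + X t))%:E)%E.
Proof.
move=> fX X0; rewrite /ergodic_capacity; congr (_ * _)%E.
(* Truncating at 0 makes [g] nonnegative on the whole line and zero off the half-line, so the domain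
   of integration can be enlarged. *)
pose g (x : R) : \bar R := (ln (1 + Num.max x 0))%:E.
transitivity (\int[mu]_x (g x * (f x)%:E))%E.
  rewrite integral_mkcond; apply: eq_integral => x _.
  rewrite patchE mem_setE in_itv/= andbT -EFinM.
  by case: ltP => x0; rewrite /g// addr0 ln1 mul0r.
rewrite (integral_pdf fX)//.
- by apply: eq_integral => t _; rewrite /g max_l.
- apply/measurable_EFinP; apply: measurableT_comp; first exact: measurable_ln.
  by apply: measurable_funD => //; apply: measurable_maxr.
- by move=> x; rewrite lee_fin ln_ge0// lerDl le_max lexx orbT.
Qed.

End capacity_bounds.

(** * Passage to the limit in [rho] *)

Lemma cvg_powRN {R : realType} (e : R) : 0 < e ->
  x `^ (- e) @[x --> +oo] --> (0 : R).
Proof.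
move=> e0; apply/cvgrPdist_le => eps eps0; near=> x.
have A0 : 0 < eps `^ (- e^-1) by exact: powR_gt0.
have Ax : eps `^ (- e^-1) <= x by near: x; exact: nbhs_pinfty_ge.
have x0 : 0 < x by exact: lt_le_trans Ax.
rewrite sub0r normrN ger0_norm ?powR_ge0// powRN -[leRHS]invrK.
rewrite lef_pV2 ?posrE ?invr_gt0 ?powR_gt0//.
have -> : eps^-1 = (eps `^ (- e^-1)) `^ e.
  by rewrite -powRrM mulNr mulVf ?gt_eqF// powR_inv1// ltW.
by rewrite ge0_ler_powR ?nnegrE ?ltW.
Unshelve. all: by end_near. Qed.

Unset Implicit Arguments.

Theorem mainTheorem9 (R : realType) (L : nat) (alpha beta : R)
  (d : R -> measure_display) (T : forall rho : R, measurableType (d rho))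
  (P : forall rho : R, probability (T rho) R)
  (snr : forall rho : R, 'I_L -> {RV (P rho) >-> R})
  (f : R -> R -> R)
  (hL : (1 <= L)%N) (halpha : 0 < alpha) (hbeta : 0 < beta)
  (snr_ge0 : forall rho : R, 0 < rho ->
     forall (l : 'I_L) (t : T rho), 0 <= snr rho l t)
  (snr_indep : forall rho : R, 0 < rho -> mutually_independent (snr rho))
  (snr_cdf : forall rho : R, 0 < rho -> forall (l : 'I_L) (x : R), 0 < x ->
     cdf (snr rho l) x = (loglogistic_cdf (rho * alpha) beta x)%:E)
  (f_pdf : forall rho : R, 0 < rho -> is_pdf (sc_snr (snr rho)) (f rho)) :
  (ergodic_capacity (f rho) - (log2 rho)%:E
     - ((beta * ln alpha + euler_mascheroni R + digamma L%:R)
          / (beta * ln 2))%:E)%E @[rho --> +oo] --> 0%E.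
Proof.
case: L hL snr snr_ge0 snr_indep snr_cdf f_pdf
  => // m _ snr _ snr_indep snr_cdf f_pdf.
(* With [L = m.+1] the Euler-Mascheroni constant cancels against the one in [digamma], leaving
   [series harmonic m]. *)
rewrite digamma_nat -(addrA (beta * ln alpha)) subrKC.
have ln2 : 0 < ln 2 :> R by rewrite ln_gt0// ltr1n.
have c0 (e : R) : 0 < e -> (rho * alpha) `^ (- e) @[rho --> +oo] --> (0 : R).
  move=> e0; apply: (cvg_comp _ _ _ (cvg_powRN e0)).
  by apply: gt0_cvgMly => //; exact: cvg_id.
(* [lo] and [up] are the error terms of the two expectation bounds at [s = rho * alpha], divided by
   [ln 2]. *)
pose lo (rho : R) : R :=
  - (ln 2)^-1 * (beta^-1 * (m%:R * (rho * alpha) `^ (- beta))).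
pose up (rho : R) : R := (ln 2)^-1 * ((rho * alpha) `^ (- 2^-1)
  + beta^-1 * (rho * alpha) `^ (- (2^-1 * beta))).
have lo0 : lo rho @[rho --> +oo] --> (0 : R).
  rewrite -[X in _ --> X](mulr0 (- (ln 2)^-1)); apply: cvgMr.
  rewrite -[X in _ --> X](mulr0 beta^-1); apply: cvgMr.
  by rewrite -[X in _ --> X](mulr0 m%:R); apply: cvgMr; exact: c0.
have up0 : up rho @[rho --> +oo] --> (0 : R).
  rewrite -[X in _ --> X](mulr0 (ln 2)^-1); apply: cvgMr.
  rewrite -[X in _ --> X](addr0 0); apply: cvgD; first by apply: c0;
    rewrite invr_gt0.
  by rewrite -[X in _ --> X](mulr0 beta^-1); apply: cvgMr; apply: c0;
    rewrite mulr_gt0 ?invr_gt0.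
apply: (@squeeze_cvge _ _ _ _ (EFin \o lo) _ (EFin \o up)); last 2 first.
- by apply: cvg_EFin => //; exact: nearW.
- by apply: cvg_EFin => //; exact: nearW.
near=> rho.
have rho0 : 0 < rho by near: rho; exact: nbhs_pinfty_gt.
have s0 : 0 < rho * alpha by rewrite mulr_gt0.
have X0 t : 0 <= sc_snr (snr rho) t by exact: max_snr_ge0.
have XF x : 0 < x ->
    cdf (sc_snr (snr rho)) x
      = (loglogistic_cdf (rho * alpha) beta x ^+ m.+1)%:E.
  by move=> x0; apply: cdf_max_snr => //; [exact: snr_indep|exact: ltW|
    move=> l; exact: snr_cdf].
rewrite (ergodic_capacityE (f_pdf _ rho0) X0) /=.
have := expectation_ln1D_ge s0 hbeta X0 XF.
have := expectation_ln1D_le s0 hbeta X0 XF.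
(* The two real bounds exclude infinite values, so the capacity is finite and the rest is real
   arithmetic. *)
case: (\int[P rho]_t _)%E => [I| |]//.
rewrite !lee_fin lnM ?posrE// => hU hL.
have i0 : 0 <= (ln 2)^-1 :> R by rewrite invr_ge0 ltW.
have := ler_wpM2l i0 hU; have := ler_wpM2l i0 hL.
have -> : (beta * ln alpha + series harmonic m) / (beta * ln 2) =
   (ln 2)^-1 * ln alpha + (ln 2)^-1 * (beta^-1 * series harmonic m).
  by field; rewrite !gt_eqF.
rewrite /lo /up /log2 !mulrDr !mulrN !mulNr (mulrC (ln rho)).
by move=> h1 h2; apply/andP; split; lra.
Unshelve. all: by end_near. Qed.
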